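(* Let $\mathcal{I}$ be an ideal on $\mathbb{N}$ with the Baire property. Then there is an $\mathcal{I}$-TAD family of cardinality $\mathfrak{c}$.
   Context: For $A\subseteq\mathbb{N}$ and $k\in\mathbb{Z}$, $A+k$ denotes $\{a+k:a\in A\}\cap\mathbb{N}$. An ideal on $\mathbb{N}$ is a family $\mathcal{I}\subseteq\mathcal{P}(\mathbb{N})$ closed under finite unions and subsets, containing all finite subsets of $\mathbb{N}$, with $\mathbb{N}\notin\mathcal{I}$. $\mathcal{I}^+=\{A\subseteq\mathbb{N}:A\notin\mathcal{I}\}$. A family $\mathcal{A}\subseteq\mathcal{P}(\mathbb{N})$ is an $\mathcal{I}$-TAD family if $\mathcal{A}\subseteq\mathcal{I}^+$ and $A\cap(B+k)\in\mathcal{I}$ for all distinct $A,B\in\mathcal{A}$ and all $k\in\mathbb{Z}$. Subsets of $\mathbb{N}$ are identified with their characteristic functions, so $\mathcal{P}(\mathbb{N})$ carries the topology of the Cantor space $\{0,1\}^{\mathbb{N}}$; an ideal has the Baire property if it has the Baire property as a subset of this space. $\mathfrak{c}$ is the cardinality of the continuum. *)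

(* Defs.v *)
From HB Require Import structures.
From mathcomp Require Import all_boot all_order all_algebra.
From mathcomp Require Import all_classical all_reals all_analysis.

Set Implicit Arguments.
Unset Strict Implicit.
Unset Printing Implicit Defensive.

Import Order.TTheory GRing.Theory Num.Theory.

Local Open Scope classical_set_scope.
Local Open Scope ring_scope.

(* The intersection with N is enforced by the type of n, while the equation
   n = a + k is between integers, so k may be negative. *)
Definition translate (A : set nat) (k : int) : set nat :=
  [set n : nat | exists2 a : nat, A a & n%:Z = a%:Z + k].

Definition is_ideal (I : set (set nat)) : Prop :=
  [/\ forall A B, I A -> I B -> I (A `|` B),
      forall A B, B `<=` A -> I A -> I B,
      forall A, finite_set A -> I A
    & ~ I [set: nat]].

Definition ideal_pos (I : set (set nat)) : set (set nat) := [set A | ~ I A].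

Definition TAD_family (I F : set (set nat)) : Prop :=
  F `<=` ideal_pos I /\
  forall A B, F A -> F B -> A <> B ->
    forall k : int, I (A `&` translate B k).

Definition nowhere_dense (T : topologicalType) (A : set T) : Prop :=
  interior (closure A) = set0.

Definition meager (T : topologicalType) (A : set T) : Prop :=
  exists2 F : nat -> set T,
    forall n, nowhere_dense (F n) & A = \bigcup_n F n.

Definition Baire_property (T : topologicalType) (A : set T) : Prop :=
  exists2 U : set T, open U & meager (A `+` U).

Definition char_fun (A : set nat) : cantor_space := fun n => n \in A.

Definition ideal_Baire_property (I : set (set nat)) : Prop :=
  Baire_property (char_fun @` I).

(* Main.v *)
Require Import Defs.
From HB Require Import structures.
From mathcomp Require Import all_boot all_order all_algebra.
From mathcomp Require Import all_classical all_reals all_analysis.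
From mathcomp Require Import zify lra.

Import Order.TTheory GRing.Theory Num.Theory.

Local Open Scope classical_set_scope.
Local Open Scope card_scope.

(** An ideal [I] with the Baire property is meager: otherwise it is comeager in
    some cylinder, and flipping the tail of a generic point there produces two
    members of [I] with cofinite union. As in Talagrand's theorem, meagerness
    gives finite blocks [[a k, b k)] carrying patterns [s k] such that a set
    matching infinitely many patterns is not in [I]; the gap after block [k] can
    be made longer than [k]. Attach to every branch [x] of the binary tree the
    union of the patterns on the blocks coded by the initial segments of [x].
    For distinct branches only finitely many blocks are shared, and a shift by
    [t] can make block [i] meet block [j <> i] only if [i, j <= |t|], so all
    shifted intersections are finite. *)

(** * Cylinders and nowhere dense sets in the Cantor space *)

Definition agree (m n : nat) (x y : cantor_space) : Prop :=
  forall i, m <= i < n -> x i = y i.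

Lemma nbhs_cylinder (x : cantor_space) n : nbhs x [set y | agree 0 n y x].
Proof.
elim: n => [|n IH]; first by apply: filterS filterT => y _ i; lia.
have xn : nbhs x [set y : cantor_space | y n = x n].
  apply: (@proj_continuous nat (fun=> bool) n x [set b | b = x n]).
  by rewrite /= /proj; apply: (@discrete_set1 bool).
apply: filterS (filterI IH xn) => y [yx yxn] i /andP[_].
by rewrite ltnS leq_eqVlt => /predU1P[->//|iltn]; apply: yx.
Qed.

Lemma nbhs_cantorP (x : cantor_space) (U : set cantor_space) :
  nbhs x U -> exists n, [set y | agree 0 n y x] `<=` U.
Proof.
pose B n := [set y | agree 0 n y x].
have FB : Filter (filter_from setT B).
  apply: filter_from_filter; first by exists 0.
  move=> i j _ _; exists (maxn i j) => // y yx.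
  by split=> k hk; apply: yx; lia.
(* The product topology is the supremum of the coordinate topologies, so one coordinate [N] at a
   time suffices, and a cylinder of length [N.+1] fixes it. *)
have Bx : filter_from setT B --> x.
  apply/cvg_sup => N V [W] [[Z] oZ <-] ZxN ZV.
  apply: (filterS ZV); exists N.+1 => // y yx; move: ZxN => /=.
  by rewrite (yx N) //=.
by move=> /Bx[n _ BU]; exists n.
Qed.

Definition cylinder_nowhere_dense (G : set cantor_space) : Prop :=
  forall x n, exists y m, agree 0 n y x /\ forall z, agree 0 m z y -> ~ G z.

Lemma nowhere_dense_cylinder (G : set cantor_space) :
  nowhere_dense G -> cylinder_nowhere_dense G.
Proof.
move=> Gnwd x n.
have [y yx yG] : exists2 y, agree 0 n y x & ~ closure G y.
  apply: contrapT => noy; suff : interior (closure G) x by rewrite Gnwd.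
  apply: filterS (nbhs_cylinder x n) => y yx.
  by apply: contrapT => yG; apply: noy; exists y.
have /nbhs_cantorP[m ym] : nbhs y (~` G).
  move/existsNP: yG => [V /not_implyP[Vy GV]].
  by apply: filterS Vy => z Vz Gz; apply: GV; exists z.
by exists y, m; split=> // z /ym.
Qed.

Lemma cylinder_nowhere_denseS (G H : set cantor_space) : G `<=` H ->
  cylinder_nowhere_dense H -> cylinder_nowhere_dense G.
Proof.
move=> GH Hnwd x n; have [y [m [yx yH]]] := Hnwd x n.
by exists y, m; split=> // z /yH + /GH.
Qed.

Lemma cylinder_nowhere_dense0 : cylinder_nowhere_dense set0.
Proof. by move=> x n; exists x, 0; split=> [i|z _ []]. Qed.

Lemma cylinder_nowhere_denseU (G H : set cantor_space) :
  cylinder_nowhere_dense G -> cylinder_nowhere_dense H ->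
  cylinder_nowhere_dense (G `|` H).
Proof.
move=> Gnwd Hnwd x n; have [y [m [yx yG]]] := Gnwd x n.
have [z [p [zy zH]]] := Hnwd y (maxn m n).
exists z, (maxn m p); split=> [i hi|w wz [Gw|Hw]].
- by rewrite zy ?yx //; lia.
- by apply: yG Gw => i hi; rewrite wz ?zy //; lia.
- by apply: zH Hw => i hi; rewrite wz //; lia.
Qed.

Lemma cylinder_nowhere_dense_bigcup (F : nat -> set cantor_space) n :
  (forall k, cylinder_nowhere_dense (F k)) ->
  cylinder_nowhere_dense [set x | exists2 k, k < n & F k x].
Proof.
move=> Fnwd; elim: n => [|n IH].
  by apply: cylinder_nowhere_denseS cylinder_nowhere_dense0 => x [].
apply: cylinder_nowhere_denseS (cylinder_nowhere_denseU _ _ IH (Fnwd n)).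
move=> x [k]; rewrite ltnS leq_eqVlt => /predU1P[->|kn] Fx; first by right.
by left; exists k.
Qed.

(** * Coordinate flips and patterns that avoid a meager set *)

Definition xorc (p x : cantor_space) : cantor_space := fun i => x i (+) p i.

Lemma xorcK p : involutive (xorc p).
Proof. by move=> x; apply/funext => i; rewrite /xorc addbK. Qed.

Lemma agree_xorc p m n x y : agree m n x y -> agree m n (xorc p x) (xorc p y).
Proof. by move=> xy i /xy; rewrite /xorc => ->. Qed.

Lemma cylinder_nowhere_dense_xorc p (G : set cantor_space) :
  cylinder_nowhere_dense G -> cylinder_nowhere_dense (xorc p @^-1` G).
Proof.
move=> Gnwd x n; have [y [m [yx yG]]] := Gnwd (xorc p x) n.
exists (xorc p y), m; split; first by rewrite -(xorcK p x); exact: agree_xorc.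
by move=> z /(agree_xorc p); rewrite xorcK; exact: yG.
Qed.

(** A cylinder missing this set yields a pattern on coordinates from [a] on that excludes [G],
    whatever precedes [a]. *)
Definition tail_saturation a (G : set cantor_space) : set cantor_space :=
  [set x | exists2 w, G w & forall i, a <= i -> w i = x i].

(* Saturating one more coordinate adds only the translate by that coordinate. *)
Lemma cylinder_nowhere_dense_tail a (G : set cantor_space) :
  cylinder_nowhere_dense G -> cylinder_nowhere_dense (tail_saturation a G).
Proof.
move=> Gnwd; elim: a => [|a IH].
  apply: cylinder_nowhere_denseS Gnwd => x [w Gw wx].
  by suff <- : w = x by []; apply/funext => i; exact: wx.
pose p : cantor_space := fun i => i == a.
apply: cylinder_nowhere_denseS
  (cylinder_nowhere_denseU _ _ IH (cylinder_nowhere_dense_xorc p _ IH)).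
move=> x [w Gw wx]; have [wxa|wxa] := eqVneq (w a) (x a).
  left; exists w => // i; rewrite leq_eqVlt => /predU1P[<-//|]; exact: wx.
right; exists w => // i; rewrite leq_eqVlt /xorc /p => /predU1P[<-|ai].
  by rewrite eqxx; case: (w a) (x a) wxa => -[].
by rewrite wx // (_ : i == a = false) ?addbF //; lia.
Qed.

Lemma nowhere_dense_block (G : set cantor_space) a :
  cylinder_nowhere_dense G ->
  exists p : nat * cantor_space,
    a <= p.1 /\ forall x, agree a p.1 x p.2 -> ~ G x.
Proof.
move=> /(cylinder_nowhere_dense_tail a)/(_ (fun=> false) a)[y [m [_ ym]]].
exists (maxn a m, y); split=> [|x xy Gx] /=; first exact: leq_maxl.
(* Overwriting [x] by [y] below [a] enters the cylinder of [y] and leaves the tail of [x]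
   unchanged. *)
apply: (ym (fun i => if i < a then y i else x i)) => [i im|].
  by case: ltnP => // ai; apply: xy => /=; lia.
by exists x => // i ai; rewrite ltnNge ai.
Qed.

(** Pattern [k] is chosen to exclude [F 0], ..., [F k] at once, so a match at any [k >= n] already
    excludes [F n]. *)
Lemma meager_blocks (F : nat -> set cantor_space) N :
  (forall k, cylinder_nowhere_dense (F k)) ->
  exists (a b : nat -> nat) (s : nat -> cantor_space),
    [/\ N <= a 0, forall k, a k <= b k, forall k, b k + k < a k.+1
      & forall x, (forall n, exists2 k, n <= k & agree (a k) (b k) x (s k)) ->
          forall n, ~ F n x].
Proof.
move=> Fnwd.
have /choice[g gP] : forall ka : nat * nat, exists p : nat * cantor_space,
    ka.2 <= p.1 /\ forall x, agree ka.2 p.1 x p.2 ->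
      ~ exists2 j, j < ka.1.+1 & F j x.
  move=> [k a]; apply: nowhere_dense_block.
  exact: cylinder_nowhere_dense_bigcup.
(* Adding [j] and a successor makes the gap after block [j] longer than [j]. *)
pose fix a k := if k is j.+1 then ((g (j, a j)).1 + j).+1 else N.
exists a, (fun k => (g (k, a k)).1), (fun k => (g (k, a k)).2).
split=> // [k|x xs n Fx]; first by have [] := gP (k, a k).
have [k nk] := xs n; have [_ /(_ x) gk] := gP (k, a k).
by move=> /gk; apply; exists n.
Qed.

(** * Unions of separated blocks and their shifts *)

Section Blocks.
Variables (a b : nat -> nat) (s : nat -> cantor_space).
Hypothesis ab : forall k, a k <= b k.
Hypothesis gap : forall k, b k + k < a k.+1.

Definition block_union (D : set nat) : set nat :=
  [set i | exists k, [/\ D k, a k <= i < b k & s k i]].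

(** The gap just before block [k] already has length at least [k]. Hence a shift that makes two
    distinct blocks meet exceeds both indices. *)
Lemma block_gap i k : i < k -> b i + k <= a k.
Proof.
elim: k => // k IH; rewrite ltnS leq_eqVlt => /predU1P[->|ik].
  by have := gap k; lia.
by have := IH ik; have := ab k; have := gap k; lia.
Qed.

Lemma block_end_homo i k : i <= k -> b i <= b k.
Proof.
rewrite leq_eqVlt => /predU1P[->//|/block_gap]; have := ab k; lia.
Qed.

Lemma block_unique i k n : a i <= n < b i -> a k <= n < b k -> i = k.
Proof.
by move=> ni nk; case: (ltngtP i k) => // /block_gap; lia.
Qed.

Lemma block_union_agree (D : set nat) k : D k ->
  agree (a k) (b k) (char_fun (block_union D)) (s k).
Proof.
move=> Dk i ik; rewrite /char_fun; apply/idP/idP => [|ski].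
  by rewrite inE => -[j [_ ij]]; rewrite (block_unique _ _ _ ij ik).
by rewrite inE; exists k.
Qed.

Lemma block_union_translate_finite (D E : set nat) M (t : int) :
  (forall j, D j -> E j -> j < M) ->
  finite_set (block_union D `&` translate (block_union E) t).
Proof.
(* A point of block [j] in the intersection comes either from block [j] itself, so [j < M], or from
   another block, so [j <= absz t]. *)
move=> DEM; apply: (sub_finite_set _ (finite_II (b (M + absz t)))).
move=> n /= [[j [Dj nj _]] [m [i [Ei mi _]] nm]].
suff /block_end_homo : j <= M + absz t by apply: leq_trans; case/andP: nj.
case: (ltngtP i j) => [/block_gap|ji|ij]; [lia| |].
  by have := block_gap _ _ ji; lia.
by rewrite ij in Ei; have := DEM j Dj Ei; lia.
Qed.

End Blocks.

(** * Branches of the binary tree as an almost disjoint family *)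

Definition branch (x : nat -> bool) : set nat :=
  [set pickle (mkseq x n) | n in [set: nat]].

Lemma branch_infinite x n : exists2 k, n <= k & branch x k.
Proof.
apply: contrapT => nobranch.
have bfin : finite_set (branch x).
  apply: (sub_finite_set _ (finite_II n)) => k xk /=; rewrite ltnNge.
  by apply/negP => nk; apply: nobranch; exists k.
have : branch x #= [set: nat].
  apply: inj_card_eq => i j _ _ /(pcan_inj pickleK)/(congr1 size).
  by rewrite !size_mkseq.
by move=> /eq_finite_set bnat; apply: infinite_nat; rewrite -bnat.
Qed.

(** A shared code comes from equal prefixes; these cannot reach past a coordinate [d] where [x] and
    [y] differ, which leaves [d.+1] codes. *)
Lemma branch_meet x y : x <> y ->
  exists M, forall j, branch x j -> branch y j -> j < M.
Proof.
move=> xy; have [d xyd] : exists d, x d <> y d.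
  by apply/existsNP => exy; apply: xy; apply/funext.
exists (\max_(n < d.+1) pickle (mkseq x n)).+1 => j [n _ <-] [m _].
move=> /(pcan_inj pickleK) yx; rewrite ltnS.
have mn : m = n by have := congr1 size yx; rewrite !size_mkseq.
have nd : n < d.+1.
  rewrite ltnS leqNgt; apply/negP => dn; apply: xyd.
  by have := congr1 (nth false ^~ d) yx; rewrite !nth_mkseq // mn.
exact: (leq_bigmax (Ordinal nd)).
Qed.

(** * Meagerness of an ideal with the Baire property *)

Lemma char_fun_inj : injective char_fun.
Proof.
move=> A B AB; apply/seteqP; split=> n /mem_set nA; apply: set_mem.
  by rewrite -[_ \in B]/(char_fun B n) -AB.
by rewrite -[_ \in A]/(char_fun A n) AB.
Qed.

Lemma char_fun_surj (x : cantor_space) : char_fun [set n | x n] = x.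
Proof.
by apply/funext => n; rewrite /char_fun /=; apply/idP/idP; rewrite inE.
Qed.

(* If the ideal were comeager in a cylinder, some [y] there and the sequence
   obtained from [y] by flipping its tail would both be in it. *)
Lemma ideal_Baire_meager (I : set (set nat)) :
  is_ideal I -> ideal_Baire_property I ->
  exists2 F : nat -> set cantor_space,
    forall k, cylinder_nowhere_dense (F k) &
    forall A, I A -> exists n, F n (char_fun A).
Proof.
move=> [IU IS Ifin IT] [U oU [F Fnwd XU]]; exists F.
  by move=> k; exact: nowhere_dense_cylinder.
suff U0 : U = set0.
  move=> A IA; have : (\bigcup_n F n) (char_fun A).
    by rewrite -XU U0; left; split; [exists A|].
  by move=> [n _ FA]; exists n.
rewrite -subset0 => x0 Ux0.
have [N NU] : exists N, [set y | agree 0 N y x0] `<=` U.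
  by apply: nbhs_cantorP; exact: open_nbhs_nbhs.
pose p : cantor_space := fun i => N <= i.
(* Avoiding every [G k] means that a point and its tail flip both avoid every [F k]. *)
pose G k := F k `|` xorc p @^-1` F k.
have Gnwd k : cylinder_nowhere_dense (G k).
  apply: cylinder_nowhere_denseU; last apply: cylinder_nowhere_dense_xorc;
  exact: nowhere_dense_cylinder.
have [a [b [s [Na ab gap sG]]]] := meager_blocks G N Gnwd.
(* This point lies in the cylinder of [x0] and matches all patterns, since every block starts at or
   after [N]. *)
pose y : cantor_space := fun i =>
  if i < N then x0 i else char_fun (block_union a b s setT) i.
have aN k : N <= a k.
  by case: k => // k; have := block_gap _ _ ab gap 0 k.+1 isT; have := ab 0; lia.
have yG n : ~ G n y.
  apply: sG => {}n; exists n => // i ni.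
  rewrite /y ltnNge (_ : N <= i) /=; last by have := aN n; lia.
  exact: (block_union_agree _ _ _ ab gap setT n).
(* A point of [U] outside all [F n] is outside the symmetric difference, hence in the image of
   [I]. *)
have IX z : agree 0 N z x0 -> (forall n, ~ F n z) -> I [set n | z n].
  move=> zx0 zF; have Uz : U z by exact: NU.
  have [[A IA Az]|nX] := pselect ((char_fun @` I) z).
    by move: Az; rewrite -{1}(char_fun_surj z) => /char_fun_inj <-.
  have : (\bigcup_n F n) z by rewrite -XU; right.
  by move=> [n _ /zF].
have yx0 : agree 0 N y x0 by move=> i /= iN; rewrite /y iN.
have Iy : I [set n | y n] by apply: IX => // n Fn; apply: (yG n); left.
have Iy' : I [set n | xorc p y n].
  apply: IX => [i iN|n Fn]; last by apply: (yG n); right.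
  by rewrite /xorc yx0 // /p leqNgt (andP iN).2 addbF.
(* Each [n >= N] lies in one of the two sets; the rest is finite. *)
apply: IT; apply: IS (IU _ _ (Ifin _ (finite_II N)) (IU _ _ Iy Iy')).
move=> n _ /=; case: (ltnP n N) => nN; first by left.
by right; rewrite /xorc /p nN addbT; case: (y n); [left|right].
Qed.

(** * Binary sequences have the cardinality of the reals *)

Lemma injective_card_le (T U : Type) (f : T -> U) :
  injective f -> [set: T] #<= [set: U].
Proof.
move=> finj; have fT : range f #= [set: T].
  by apply: inj_card_eq => x y _ _; exact: finj.
by rewrite -(card_le_eql fT); exact: card_leT.
Qed.

Section Continuum.
Variable R : realType.
Local Open Scope ring_scope.

Definition ternary_sum (x : nat -> bool) n : R :=
  \sum_(i < n) (x i)%:R / 3 ^+ i.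

Definition ternary_real (x : nat -> bool) : R := sup (range (ternary_sum x)).

Lemma ternary_sumS x n :
  ternary_sum x n.+1 = ternary_sum x n + (x n)%:R / 3 ^+ n.
Proof. by rewrite /ternary_sum big_ord_recr. Qed.

Lemma ternary_sum_le x m n : (m <= n)%N -> ternary_sum x m <= ternary_sum x n.
Proof.
move=> /subnK <-; elim: (n - m)%N => // k IH; apply: (le_trans IH).
by rewrite addSn ternary_sumS lerDl divr_ge0 ?exprn_ge0.
Qed.

Lemma ternary_sum_ub x m n :
  ternary_sum x n <= ternary_sum x m + 3 / 2 / 3 ^+ m.
Proof.
have e0 k : 0 < (3 ^+ k)^-1 :> R by rewrite invr_gt0 exprn_gt0.
have [nm|/ltnW/subnK <-] := leqP n m.
  by have := ternary_sum_le x _ _ nm; have := e0 m; lra.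
(* The term [3 / 2 / 3 ^+ m] is the largest possible tail from [m] on; the partial sum plus this
   bound is nonincreasing, which makes the induction work. *)
suff: ternary_sum x (n - m + m) + 3 / 2 / 3 ^+ (n - m + m)
    <= ternary_sum x m + 3 / 2 / 3 ^+ m by have := e0 (n - m + m)%N; lra.
elim: (n - m)%N => // k IH; apply: le_trans IH.
rewrite addSn ternary_sumS exprS invfM.
by have := e0 (k + m)%N; case: (x _) => /=; lra.
Qed.

Lemma ternary_real_bounds x m :
  ternary_sum x m <= ternary_real x <= ternary_sum x m + 3 / 2 / 3 ^+ m.
Proof.
apply/andP; split.
  apply: ub_le_sup; last by exists m.
  exists (ternary_sum x 0 + 3 / 2 / 3 ^+ 0) => _ [n _ <-].
  exact: ternary_sum_ub.
apply: ge_sup; first by exists (ternary_sum x 0), 0%N.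
by move=> _ [n _ <-]; exact: ternary_sum_ub.
Qed.

(** At the least differing digit [d] the sums split by [1 / 3 ^+ d], and later digits recover at
    most half of that. *)
Lemma ternary_real_inj : injective ternary_real.
Proof.
move=> x y xyE; apply: contrapT => xy.
have exd : exists d, x d != y d.
  apply: contrapT => /forallNP nod; apply: xy; apply/funext => d.
  by apply/eqP; have /negP := nod d; rewrite negbK.
have [d xyd dmin] := ex_minnP exd.
have xyS : ternary_sum x d = ternary_sum y d.
  apply: eq_bigr => -[i /= id] _; congr ((nat_of_bool _)%:R / _).
  by apply: contraTeq id => /dmin; rewrite -leqNgt.
have e0 : 0 < (3 ^+ d)^-1 :> R by rewrite invr_gt0 exprn_gt0.
have := ternary_real_bounds x d.+1; have := ternary_real_bounds y d.+1.
rewrite xyE !ternary_sumS xyS exprS invfM.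
by case: (x d) (y d) xyd => -[] //= _; lra.
Qed.

(** The Dedekind cut of [r] read through the coding of the rationals; numbers coding no rational get
    the default [false]. *)
Definition rational_cut (r : R) : nat -> bool :=
  fun n => if unpickle n is Some q then ratr q < r else false.

Lemma rational_cut_inj : injective rational_cut.
Proof.
suff cut_lt r1 r2 : r1 < r2 -> rational_cut r1 <> rational_cut r2.
  by move=> r1 r2 e; case: (ltgtP r1 r2) => // /cut_lt; rewrite e.
move=> /rat_in_itvoo[q]; rewrite in_itv /= => /andP[r1q qr2].
move=> /(congr1 (fun f => f (pickle q))).
by rewrite /rational_cut pickleK qr2 ltNge (ltW r1q).
Qed.

Lemma card_cantor_real : [set: nat -> bool] #= [set: R].
Proof.
rewrite card_eq_le; apply/andP; split.
  exact: injective_card_le ternary_real_inj.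
exact: injective_card_le rational_cut_inj.
Qed.

End Continuum.

(** * Assembling the family *)

Theorem theorem3p2 (R : realType) (I : set (set nat)) :
  is_ideal I -> ideal_Baire_property I ->
  exists2 F : set (set nat), TAD_family I F & F #= [set: R].
Proof.
move=> II IB; have [F Fnwd IF] := ideal_Baire_meager I II IB.
have [_ _ Ifin _] := II.
have [a [b [s [_ ab gap sF]]]] := meager_blocks F 0 Fnwd.
pose A x := block_union a b s (branch x).
have Apos x : ~ I (A x).
  move=> /IF[n]; apply: sF => {}n; have [k nk xk] := branch_infinite x n.
  by exists k => //; exact: block_union_agree.
have Ameet x y t : x <> y -> finite_set (A x `&` translate (A y) t).
  by move=> /branch_meet[M]; exact: block_union_translate_finite.
have Ainj : injective A.
  (* If two branches gave the same set, the zero shift would make it finite, hence a member of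
     [I]. *)
  move=> x y Axy; apply: contrapT => xy; apply: (Apos x); apply: Ifin.
  apply: sub_finite_set (Ameet x y 0%R xy) => n An; split=> //.
  by exists n; rewrite -?Axy // GRing.addr0.
exists (range A).
  split=> [_ [x _ <-]|_ _ [x _ <-] [y _ <-] Axy k]; first exact: Apos.
  by apply: Ifin; apply: Ameet => xy; apply: Axy; rewrite xy.
apply: card_eq_trans (card_cantor_real R).
by apply: inj_card_eq => x y _ _; exact: Ainj.
Qed.
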